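(* Let $N$ be a positive integer, let $\mathbb{K}$ be a field, and let $X=(x_1,\dots,x_{N-1})$ and $Y=(y_1,\dots,y_{N-2})$ be arbitrary sequences of elements of $\mathbb{K}$. Then the map $\sigma\mapsto \mathsf{E}_\sigma$ is a bijection from the symmetric group $\mathfrak{S}_N$ to the Okada monoid $\mathsf{O}_N$, and the family $(\mathsf{E}_\sigma)_{\sigma\in\mathfrak{S}_N}$ is a basis of the Okada algebra $\mathsf{O}_N(X,Y)$. In particular, the dimension of $\mathsf{O}_N(X,Y)$ over $\mathbb{K}$ is always $N!$.
   Context: The Okada algebra $\mathsf{O}_N(X,Y)$ is the associative unital $\mathbb{K}$-algebra generated by $\mathsf{E}_1,\dots,\mathsf{E}_{N-1}$ with relations $\mathsf{E}_i^2=x_i\mathsf{E}_i$ for $1\le i\le N-1$; $\mathsf{E}_i\mathsf{E}_j=\mathsf{E}_j\mathsf{E}_i$ for $|i-j|\ge 2$; $\mathsf{E}_{i+1}\mathsf{E}_i\mathsf{E}_{i+1}=y_i\mathsf{E}_{i+1}$ for $1\le i\le N-2$. The Okada monoid $\mathsf{O}_N$ is the monoid presented by generators $\mathsf{E}_1,\dots,\mathsf{E}_{N-1}$ and the same relations with all $x_i$ and $y_i$ equal to $1$. The code of $\sigma\in\mathfrak{S}_N$ is $(c_1,\dots,c_N)$ with $c_i=\#\{j<i \mid \sigma^{-1}(j)>\sigma^{-1}(i)\}$. One sets $\mathsf{E}_\sigma=\prod_{i=1}^N \mathsf{E}_{i-1}\mathsf{E}_{i-2}\cdots\mathsf{E}_{i-c_i}$,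 where the product is taken from left to right with $i$ increasing and the $i$-th factor is empty when $c_i=0$. The same formula defines $\mathsf{E}_\sigma$ in the algebra and in the monoid. *)

(* Defs.v *)
From HB Require Import structures.
From mathcomp Require Import all_boot all_order all_fingroup all_algebra.
From mathcomp Require Import generic_quotient ring_quotient.
From mathcomp Require Import boolp.
From mathcomp Require Import monalg.

Set Implicit Arguments.
Unset Strict Implicit.
Unset Printing Implicit Defensive.

Import GRing.Theory.

Local Open Scope quotient_scope.
Local Open Scope ring_scope.

(* Generators are indexed from 0: the letter [i : 'I_N.-1] stands for the
   generator E_(i+1) of the usual numbering E_1, ..., E_(N-1).  Likewise,
   [tnth X i] is x_(i+1), [tnth Y k] is y_(k+1), and a permutation
   [s : 'S_N] acts on {0, ..., N-1} instead of {1, ..., N}. *)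

Section Code.
Variable N : nat.
Implicit Types (s : 'S_N) (p : 'I_N).

Definition code s p : nat :=
  #|[set q : 'I_N | (q < p)%N && ((s^-1)%g p < (s^-1)%g q)%N]|.

Lemma code_le s p : (code s p <= p)%N.
Proof.
apply: (@leq_trans #|[set q : 'I_N | (q < p)%N]|).
  by apply: subset_leq_card; apply/subsetP => q; rewrite !inE => /andP[].
by rewrite -sum1dep_card (big_ord_narrow (ltnW (ltn_ord p))) sum1_card card_ord.
Qed.

Fact code_letter_subproof s p (k : 'I_(code s p)) : (p - k.+1 < N.-1)%N.
Proof.
have kp : (k < p)%N := leq_trans (ltn_ord k) (code_le s p).
have pN : (p <= N.-1)%N by rewrite -ltnS (ltn_predK (ltn_ord p)).
by apply: leq_trans pN; rewrite ltn_subrL (leq_trans _ kp).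
Qed.

(* For the position i = p+1, the letters at k = 0, ..., c_i - 1 are
   E_(i-1), ..., E_(i-c_i); the generator E_(i-1-k) has index p-(k+1). *)
Definition code_letter s p (k : 'I_(code s p)) : 'I_N.-1 :=
  Ordinal (code_letter_subproof k).

Definition code_prod (T : Type) (one : T) (mul : T -> T -> T)
    (E : 'I_N.-1 -> T) s : T :=
  \big[mul/one]_(p < N) \big[mul/one]_(k < code s p) E (code_letter k).

End Code.

Section PresentedMonoid.
Variables (I : choiceType) (R : {fmonom I} -> {fmonom I} -> Prop).

Inductive congruence : {fmonom I} -> {fmonom I} -> Prop :=
| Cong_rel u v : R u v -> congruence u v
| Cong_refl u : congruence u u
| Cong_sym u v : congruence u v -> congruence v u
| Cong_trans u v w : congruence u v -> congruence v w -> congruence u w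
| Cong_mul u u' v v' :
    congruence u u' -> congruence v v' ->
    congruence (mmul u v) (mmul u' v').

Definition congb (u v : {fmonom I}) : bool := `[< congruence u v >].

Fact congb_equiv : equiv_class_of congb.
Proof.
split=> [u|u v|v u w].
- exact/asboolP/Cong_refl.
- by apply/asboolP/asboolP; apply: Cong_sym.
- by move=> /asboolP uv /asboolP vw; apply/asboolP/(Cong_trans uv vw).
Qed.

Canonical congb_equiv_rel := EquivRelPack congb_equiv.
Canonical congb_encModRel := defaultEncModRel congb.

Definition presented_monoid := {eq_quot congb}.
HB.instance Definition _ := EqQuotient.on presented_monoid.
HB.instance Definition _ := Choice.on presented_monoid.

Definition pm_pi (u : {fmonom I}) : presented_monoid :=
  \pi_presented_monoid u.
Definition pm_one : presented_monoid := pm_pi mone.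
Definition pm_mul (a b : presented_monoid) : presented_monoid :=
  pm_pi (mmul (repr a) (repr b)).

Lemma pm_piE u v : pm_pi u = pm_pi v <-> congruence u v.
Proof.
split=> [/eqP|uv]; first by rewrite piE => /asboolP.
by apply/eqP; rewrite piE; apply/asboolP.
Qed.

Lemma pm_reprK : cancel repr pm_pi.
Proof. exact: reprK. Qed.

Lemma pm_piM u v : pm_pi (mmul u v) = pm_mul (pm_pi u) (pm_pi v).
Proof. by apply/pm_piE/Cong_mul; apply/pm_piE; rewrite pm_reprK. Qed.

Fact pm_mulA : associative pm_mul.
Proof.
move=> a b c; rewrite -[a]pm_reprK -[b]pm_reprK -[c]pm_reprK -!pm_piM.
by rewrite mulmA.
Qed.

Fact pm_mul1m : left_id pm_one pm_mul.
Proof. by move=> a; rewrite -[a]pm_reprK -pm_piM mul1m. Qed.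

Fact pm_mulm1 : right_id pm_one pm_mul.
Proof. by move=> a; rewrite -[a]pm_reprK -pm_piM mulm1. Qed.

HB.instance Definition _ :=
  isMonoid.Build presented_monoid pm_mulA pm_mul1m pm_mulm1.

End PresentedMonoid.

Inductive okada_mrel (N : nat) :
    {fmonom 'I_N.-1} -> {fmonom 'I_N.-1} -> Prop :=
| OkM_idem (i : 'I_N.-1) :
    okada_mrel (mmul (fmu i) (fmu i)) (fmu i)
| OkM_comm (i j : 'I_N.-1) :
    (i.+1 < j)%N || (j.+1 < i)%N ->
    okada_mrel (mmul (fmu i) (fmu j)) (mmul (fmu j) (fmu i))
| OkM_braid (i j : 'I_N.-1) :
    j = i.+1 :> nat ->
    okada_mrel (mmul (mmul (fmu j) (fmu i)) (fmu j)) (fmu j).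

Definition okada_monoid (N : nat) : monoidType :=
  presented_monoid (@okada_mrel N).

Definition okada_mgen (N : nat) (i : 'I_N.-1) : okada_monoid N :=
  pm_pi (@okada_mrel N) (fmu i).

Definition okada_monoid_elt (N : nat) (s : 'S_N) : okada_monoid N :=
  code_prod 1%g mulg (@okada_mgen N) s.

Section GeneratedIdeal.
Variables (A : pzRingType) (S : A -> Prop).

Inductive generated_ideal : A -> Prop :=
| Gen_ideal0 : generated_ideal 0
| Gen_idealD a s b u :
    S s -> generated_ideal u -> generated_ideal (a * s * b + u).

Lemma generated_idealD u v :
  generated_ideal u -> generated_ideal v -> generated_ideal (u + v).
Proof.
move=> Iu Iv; elim: Iu => [|a s b w Ss _ IH]; first by rewrite add0r.
by rewrite -addrA; apply: Gen_idealD.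
Qed.

Lemma generated_idealM c d u :
  generated_ideal u -> generated_ideal (c * u * d).
Proof.
elim=> [|a s b w Ss _ IH]; first by rewrite mulr0 mul0r; apply: Gen_ideal0.
rewrite mulrDr mulrDl; suff -> : c * (a * s * b) * d = (c * a) * s * (b * d).
  exact: Gen_idealD.
by rewrite !mulrA.
Qed.

Lemma generated_idealN u : generated_ideal u -> generated_ideal (- u).
Proof. by move=> /(generated_idealM (-1) 1); rewrite mulN1r mulr1. Qed.

Lemma generated_ideal_sub s : S s -> generated_ideal s.
Proof.
move=> Ss; rewrite -[s]mul1r -[_ * _]mulr1 -[_ * _ * _]addr0.
by apply: Gen_idealD => //; apply: Gen_ideal0.
Qed.

End GeneratedIdeal.

Section OkadaAlgebra.
Variables (N : nat) (K : fieldType) (X : N.-1.-tuple K) (Y : N.-2.-tuple K).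

(* The monoid algebra of the free monoid, i.e. the free associative unital
   algebra on the generators. *)
Notation free_algebra := {malg K[{fmonom 'I_N.-1}]}.

Definition okada_fgen (i : 'I_N.-1) : free_algebra := << fmu i >>.

Local Notation E := okada_fgen.

Inductive okada_relator : free_algebra -> Prop :=
| OkA_idem (i : 'I_N.-1) :
    okada_relator (E i * E i - tnth X i *: E i)
| OkA_comm (i j : 'I_N.-1) :
    (i.+1 < j)%N || (j.+1 < i)%N ->
    okada_relator (E i * E j - E j * E i)
| OkA_braid (k : 'I_N.-2) (i j : 'I_N.-1) :
    i = k :> nat -> j = k.+1 :> nat ->
    okada_relator (E j * E i * E j - tnth Y k *: E j).

Definition okada_ideal : {pred free_algebra} :=
  fun a => `[< generated_ideal okada_relator a >].

Lemma okada_idealP a :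
  reflect (generated_ideal okada_relator a) (a \in okada_ideal).
Proof. exact: asboolP. Qed.

Fact okada_ideal_zmod_closed : zmod_closed okada_ideal.
Proof.
split=> [|u v /okada_idealP Iu /okada_idealP Iv]; apply/okada_idealP.
  exact: Gen_ideal0.
exact/generated_idealD/generated_idealN.
Qed.

HB.instance Definition _ :=
  GRing.isZmodClosed.Build free_algebra okada_ideal okada_ideal_zmod_closed.

Lemma okada_idealM c d u : u \in okada_ideal -> c * u * d \in okada_ideal.
Proof. by move=> /okada_idealP Iu; apply/okada_idealP/generated_idealM. Qed.

(* The ideal lies in the kernel of the augmentation, hence is proper. *)
Lemma okada_ideal1 : 1 \notin okada_ideal.
Proof.
have E0 i : (E i)@_mone = 0.
  by rewrite mcoeffU1; case: eqP => // /(congr1 (@fdeg _)); rewrite fdegU fdeg1.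
suff I0 u : generated_ideal okada_relator u -> u@_mone = 0.
  by apply/okada_idealP => /I0 /eqP; rewrite rmorph1 oner_eq0.
elim=> [|a s b w Ss _ IH]; first exact: mcoeff0.
rewrite mcoeffD IH addr0 !rmorphM /=.
suff -> : s@_mone = 0 by rewrite mulr0 mul0r.
by case: Ss => *; rewrite mcoeffB ?mcoeffZ !rmorphM /= !E0 ?(mul0r, mulr0) subrr.
Qed.

Definition okada_algebra := Quotient.quot okada_ideal.
HB.instance Definition _ := GRing.Zmodule.on okada_algebra.

Definition oka_pi (a : free_algebra) : okada_algebra := \pi_okada_algebra a.

Lemma oka_piE a b : oka_pi a = oka_pi b <-> a - b \in okada_ideal.
Proof. by rewrite Quotient.idealrBE; split=> /eqP. Qed.

Lemma oka_reprK : cancel repr oka_pi.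
Proof. exact: reprK. Qed.

Lemma oka_piD : {morph oka_pi : a b / a + b}.
Proof. by move=> a b; rewrite /oka_pi raddfD. Qed.

Definition oka_one : okada_algebra := oka_pi 1.
Definition oka_mul (a b : okada_algebra) := oka_pi (repr a * repr b).
Definition oka_scale (c : K) (a : okada_algebra) := oka_pi (c *: repr a).

Lemma malg_scaleAr (c : K) (a b : free_algebra) : c *: (a * b) = a * (c *: b).
Proof.
have cC (d : K) (u : free_algebra) : d *: u = u * << d *g mone >>.
  rewrite [RHS]fgmulgU; apply/malgP => m.
  rewrite mcoeffZ raddf_sum /= {1}(monalgE u) raddf_sum /= mulr_sumr.
  by apply: eq_bigr => k _; rewrite mulm1 !mcoeffU mulrnAr mulrC.
by rewrite !cC mulrA.
Qed.

Lemma oka_piM a b : oka_pi (a * b) = oka_mul (oka_pi a) (oka_pi b).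
Proof.
apply/oka_piE.
have Ia c : c - repr (oka_pi c) \in okada_ideal.
  by apply/oka_piE; rewrite oka_reprK.
set a' := repr _; set b' := repr _.
have -> : a * b - a' * b' = 1 * (a - a') * b + a' * (b - b') * 1.
  by rewrite mul1r mulr1 mulrBl mulrBr addrA subrK.
by apply: rpredD; apply: okada_idealM; apply: Ia.
Qed.

Lemma oka_piZ c a : oka_pi (c *: a) = oka_scale c (oka_pi a).
Proof.
apply/oka_piE; rewrite -scalerBr; set u := _ - _.
have -> : c *: u = (c *: 1) * u * 1 by rewrite mulr1 -scalerAl mul1r.
by apply/okada_idealM/oka_piE; rewrite oka_reprK.
Qed.

Fact oka_mulA : associative oka_mul.
Proof.
move=> a b c; rewrite -[a]oka_reprK -[b]oka_reprK -[c]oka_reprK -!oka_piM.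
by rewrite mulrA.
Qed.

Fact oka_mul1 : left_id oka_one oka_mul.
Proof. by move=> a; rewrite -[a]oka_reprK -oka_piM mul1r. Qed.

Fact oka_mulr1 : right_id oka_one oka_mul.
Proof. by move=> a; rewrite -[a]oka_reprK -oka_piM mulr1. Qed.

Fact oka_mulDl : left_distributive oka_mul +%R.
Proof.
move=> a b c; rewrite -[a]oka_reprK -[b]oka_reprK -[c]oka_reprK.
by rewrite -oka_piD -!oka_piM -oka_piD mulrDl.
Qed.

Fact oka_mulDr : right_distributive oka_mul +%R.
Proof.
move=> a b c; rewrite -[a]oka_reprK -[b]oka_reprK -[c]oka_reprK.
by rewrite -oka_piD -!oka_piM -oka_piD mulrDr.
Qed.

Fact oka_one_neq0 : oka_one != 0.
Proof.
apply/eqP => e; have : oka_pi 1 = oka_pi 0 by rewrite /oka_pi raddf0.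
by move/oka_piE; rewrite subr0 (negPf okada_ideal1).
Qed.

HB.instance Definition _ := GRing.Zmodule_isNzRing.Build okada_algebra
  oka_mulA oka_mul1 oka_mulr1 oka_mulDl oka_mulDr oka_one_neq0.

Fact oka_scaleA c d a : oka_scale c (oka_scale d a) = oka_scale (c * d) a.
Proof. by rewrite -[a]oka_reprK -!oka_piZ scalerA. Qed.

Fact oka_scale1 : left_id 1 oka_scale.
Proof. by move=> a; rewrite -[a]oka_reprK -oka_piZ scale1r. Qed.

Fact oka_scaleDr : right_distributive oka_scale +%R.
Proof.
move=> c a b; rewrite -[a]oka_reprK -[b]oka_reprK.
by rewrite -oka_piD -!oka_piZ -oka_piD scalerDr.
Qed.

Fact oka_scaleDl a : {morph oka_scale^~ a : c d / c + d}.
Proof. by move=> c d; rewrite -[a]oka_reprK -!oka_piZ -oka_piD scalerDl. Qed.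

HB.instance Definition _ := GRing.Zmodule_isLmodule.Build K okada_algebra
  oka_scaleA oka_scale1 oka_scaleDr oka_scaleDl.

Fact oka_scaleAl (c : K) (a b : okada_algebra) : c *: (a * b) = (c *: a) * b.
Proof.
rewrite -[a]oka_reprK -[b]oka_reprK /GRing.scale /GRing.mul /=.
by rewrite -!(oka_piM, oka_piZ) scalerAl.
Qed.

HB.instance Definition _ :=
  GRing.Lmodule_isLalgebra.Build K okada_algebra oka_scaleAl.

Fact oka_scaleAr (c : K) (a b : okada_algebra) : c *: (a * b) = a * (c *: b).
Proof.
rewrite -[a]oka_reprK -[b]oka_reprK /GRing.scale /GRing.mul /=.
by rewrite -!(oka_piM, oka_piZ) malg_scaleAr.
Qed.

HB.instance Definition _ :=
  GRing.Lalgebra_isAlgebra.Build K okada_algebra oka_scaleAr.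

Definition okada_agen (i : 'I_N.-1) : okada_algebra := oka_pi (okada_fgen i).

Definition okada_algebra_elt (s : 'S_N) : okada_algebra :=
  code_prod 1 *%R okada_agen s.

End OkadaAlgebra.

(* [basis_of] of the library presupposes a finite-dimensional space. *)
Definition is_basis (K : fieldType) (V : lmodType K) (I : finType)
    (v : I -> V) : Prop :=
  (forall c : I -> K, \sum_i c i *: v i = 0 -> forall i, c i = 0) /\
  (forall u : V, exists c : I -> K, u = \sum_i c i *: v i).

Definition has_dim (K : fieldType) (V : lmodType K) (n : nat) : Prop :=
  inhabited (Vector.axiom n V).

(* Main.v *)
Require Import Defs.
From mathcomp Require Import all_boot all_fingroup all_algebra.
From HB Require Import structures.
From mathcomp Require Import generic_quotient zify boolp monalg.

(* The words E_sigma are the products of descending runs D(0,a_0) D(1,a_1) ...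
   D(N-1,a_(N-1)) with a_p <= p, where D(p,a) = E_(p-1) ... E_a (indices from
   0).  When a < j < p, the relations give
     D(p,a) E_j = y_(j-1) D(j-1,a) D(p,j),
   while for j <= a the effect of E_j on the last run is immediate.  These
   formulas define, by recursion on the number of runs, a right action of the
   generators on scalar multiples of states (a_0, ..., a_(N-1)).
   Independence: a case analysis shows that this action satisfies the Okada
   relations, and E_sigma sends the state of the empty word to the state of
   sigma.  Spanning: evaluating a state as a word is compatible with the
   action, so every word is a scalar multiple of some E_sigma.  The same
   computations cover the monoid, where scalars act trivially. *)

Set Implicit Arguments.
Unset Strict Implicit.
Unset Printing Implicit Defensive.

Import GRing.Theory.

Local Open Scope ring_scope.

(** * Descending runs of indices *)

Definition desc (b a : nat) : seq nat := rev (iota a (b - a)).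

Lemma mem_desc b a i : (i \in desc b a) = (a <= i < b)%N.
Proof. by rewrite mem_rev mem_iota; lia. Qed.

Lemma desc_nil b a : (b <= a)%N -> desc b a = [::].
Proof. by rewrite -subn_eq0 /desc => /eqP ->. Qed.

Lemma desc_rcons b a : (a < b)%N -> desc b a = rcons (desc b a.+1) a.
Proof. by move=> ab; rewrite /desc -subnSK // rev_cons. Qed.

Lemma desc_cat b c a : (a <= c <= b)%N -> desc b a = desc b c ++ desc c a.
Proof.
move=> /andP[ac cb]; rewrite /desc.
have -> : (b - a = (c - a) + (b - c))%N by lia.
by rewrite iotaD rev_cat subnKC.
Qed.

Lemma desc_cons b a : (a <= b)%N -> desc b.+1 a = b :: desc b a.
Proof.
move=> ab; rewrite (@desc_cat _ b) ?ab ?leqnSn //.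
by rewrite {1}/desc subSn // subnn.
Qed.

(** * Okada modules and the universal action *)

Section OkadaModules.

Variables (K : fieldType) (x y : nat -> K).

(* Only the scaling action of [K] is needed, so that monoids are covered too:
   there [scale] is trivial, whatever [x] and [y] are. *)
Record okada_module (m : nat) (T : Type) (scale : K -> T -> T)
    (act : T -> nat -> T) : Prop := OkadaModule {
  om_scaleA : forall k l t, scale k (scale l t) = scale (k * l) t;
  om_actZ : forall k t j, act (scale k t) j = scale k (act t j);
  om_idem : forall t i, (i < m)%N -> act (act t i) i = scale (x i) (act t i);
  om_comm : forall t i j, (i.+1 < j < m)%N ->
    act (act t i) j = act (act t j) i;
  om_braid : forall t i, (i.+1 < m)%N ->
    act (act (act t i.+1) i) i.+1 = scale (y i) (act t i.+1) }.

(** * Letters and descending runs in an Okada module *)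

Section Descents.

Variables (m : nat) (T : Type) (scale : K -> T -> T) (act : T -> nat -> T).
Hypothesis omT : okada_module m scale act.
Local Notation run := (foldl act).

Lemma run_scale k t w : run (scale k t) w = scale k (run t w).
Proof. by elim: w t => //= i w IH t; rewrite (om_actZ omT) IH. Qed.

Lemma scaleC k l t : scale k (scale l t) = scale l (scale k t).
Proof. by rewrite !(om_scaleA omT) mulrC. Qed.

Lemma act_run t i w :
    (i < m)%N -> {in w, forall j, (i.+1 < j < m)%N || (j.+1 < i)%N} ->
  act (run t w) i = run (act t i) w.
Proof.
move=> im; elim: w t => //= j w IH t wP; rewrite IH; last first.
  by move=> k kw; apply: wP; rewrite inE kw orbT.
congr (run _ w); case/orP: (wP j (mem_head _ _)) => ij.
  by rewrite -(om_comm omT).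
by rewrite (om_comm omT) // ij.
Qed.

Lemma run_run t v w :
    {in v & w, forall i j, (i.+1 < j < m)%N && (i < m)%N} ->
  run (run t v) w = run (run t w) v.
Proof.
elim: v t => //= i v IH t vwP; rewrite IH; last first.
  by move=> k j kv; apply: vwP; rewrite inE kv orbT.
(* The bound [i < m] is read off a letter of [w]; an empty [w] is immediate. *)
case: w vwP {IH} => // j w vwP; rewrite [in RHS]act_run //.
  by case/andP: (vwP i j (mem_head _ _) (mem_head _ _)).
by move=> l lw; case/andP: (vwP i l (mem_head _ _) lw) => ->.
Qed.

Lemma act_desc_last t b a :
  (a < b <= m)%N -> act (run t (desc b a)) a = scale (x a) (run t (desc b a)).
Proof.
by move=> abm; rewrite desc_rcons ?foldl_rcons ?(om_idem omT) //; lia.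
Qed.

(** Commuting E_j left past the letters below j-1 brings it next to E_j E_(j-1), and the braid
    relation leaves y_(j-1) E_j. The letters below j-1 then commute past those from j up. *)
Lemma act_desc_mid t b a j : (a < j < b)%N -> (b <= m)%N ->
  act (run t (desc b a)) j =
    scale (y j.-1) (run (run t (desc j.-1 a)) (desc b j)).
Proof.
case: j => // j /andP[aj jb] bm /=.
rewrite (@desc_cat b j.+1 a) ?foldl_cat; last lia.
rewrite desc_cons //= act_run; first last.
- by move=> i; rewrite mem_desc; lia.
- lia.
rewrite desc_rcons // foldl_rcons (om_braid omT); last lia.
rewrite run_scale; congr (scale _ _).
rewrite -foldl_rcons -desc_rcons // -run_run // => i k.
by rewrite !mem_desc; lia.
Qed.

End Descents.

(* The state [a :: s], where [s] has size [p], stands for the word of [s]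
   followed by the descending run p-1, ..., a. *)
Fixpoint act (n : nat) (t : K * seq nat) (j : nat) : K * seq nat :=
  match n, t with
  | n.+1, (k, a :: s) =>
      if (j.+1 < a)%N then let u := act n (k, s) j in (u.1, a :: u.2)
      else if j.+1 == a then (k, j :: s)
      else if j == a then (x j * k, a :: s)
      else let u := foldl (act n) (y j.-1 * k, s) (desc j.-1 a) in
           (u.1, j :: u.2)
  | _, _ => (0, [::])
  end.

Definition st_scale (k : K) (t : K * seq nat) := (k * t.1, t.2).

Local Notation push a t := (t.1, a :: t.2).

(** This lemma and the next three separate the positions of [j] relative to the top entry: E_j
    commutes with the top run, lengthens it by one letter, squares its last letter, or crosses
    it. *)
Lemma act_low n t a j :
  (j.+1 < a)%N -> act n.+1 (push a t) j = push a (act n t j).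
Proof. by case: t => k s ja /=; rewrite ja. Qed.

Lemma act_extend n t j : act n.+1 (push j.+1 t) j = push j t.
Proof. by rewrite /= ltnn eqxx. Qed.

Lemma act_same n t j : act n.+1 (push j t) j = st_scale (x j) (push j t).
Proof. by rewrite /= ltnNge leqnSn -[_ == j]negbK neq_ltn ltnSn orbT /= eqxx. Qed.

Lemma act_high n t a j : (a < j)%N ->
  act n.+1 (push a t) j =
    push j (foldl (act n) (st_scale (y j.-1) t) (desc j.-1 a)).
Proof.
by move=> aj /=; rewrite ltnNge (leqW (ltnW aj)) /= !gtn_eqF //= leqW.
Qed.

Lemma act0 n j k : act n (k, [::]) j = (0, [::]).
Proof. by case: n. Qed.

Arguments act : simpl never.

Lemma st_scaleA k l t : st_scale k (st_scale l t) = st_scale (k * l) t.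
Proof. by rewrite /st_scale /= mulrA. Qed.

Lemma push_scale k a t : push a (st_scale k t) = st_scale k (push a t).
Proof. by []. Qed.

Lemma act_scale n k t j : act n (st_scale k t) j = st_scale k (act n t j).
Proof.
elim: n k t j => [|n IH] k [l [|a s]] j; rewrite ?act0 //.
1,2,3: by rewrite /st_scale /= mulr0.
have runZ c t w : foldl (act n) (st_scale c t) w =
    st_scale c (foldl (act n) t w).
  by elim: w t => //= i w IHw t; rewrite IH IHw.
rewrite -[st_scale k _]/(push a (st_scale k (l, s))) -[(l, a :: s)]/(push a (l, s)).
move: (l, s) => {l s} t.
case: (ltngtP j.+1 a) => [ja|aj|<-].
- by rewrite !act_low // IH.
- move: aj; rewrite ltnS leq_eqVlt => /orP[/eqP->|aj].
    by rewrite !act_same push_scale !st_scaleA mulrC.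
  by rewrite !act_high // !st_scaleA mulrC -st_scaleA runZ.
- by rewrite !act_extend.
Qed.

(** By induction on [n]: indices well below the top entry are handled by the relations at depth [n];
    in the other positions the identities on runs, used at depth [n], make both sides agree. *)
Lemma act_okada_module m n : okada_module m st_scale (act n).
Proof.
(* Depth 0 and the empty list both lead to the zero vector [(0, [::])], which scalars and the action
   fix, so the relations also hold on ill-formed states. *)
have empty_scale k : st_scale k (0, [::]) = (0, [::]).
  by rewrite /st_scale mulr0.
elim: n m => [|n IH] m; first by split=> // k *; rewrite ?st_scaleA ?empty_scale.
split; first exact: st_scaleA; first exact: act_scale.
- move=> [k [|a s]] i im; first by rewrite !act0 empty_scale.
  rewrite -[(k, a :: s)]/(push a (k, s)).
  case: (ltngtP i.+1 a) => [ia|ai|<-].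
  + by rewrite !act_low // (om_idem (IH m)).
  + move: ai; rewrite ltnS leq_eqVlt => /orP[/eqP->|ai].
      by rewrite !act_same -push_scale act_same push_scale.
    by rewrite act_high // act_same.
  + by rewrite !act_extend act_same.
- move=> [k [|a s]] i j /andP[ij jm]; first by rewrite !act0.
  rewrite -[(k, a :: s)]/(push a (k, s)); move: (k, s) => {k s} t.
  case: (ltngtP j.+1 a) => [ja|aj|<-].
  + have ia : (i.+1 < a)%N by lia.
    by rewrite !act_low // (om_comm (IH m)) ?ij.
  + move: aj; rewrite ltnS leq_eqVlt => /orP[/eqP->|aj].
      rewrite !(act_same, act_low, act_scale) //=.
    rewrite (act_high _ _ aj).
    (* Crossing the top run, E_j leaves D(j-1,a) to act below. E_i commutes with this run if i+1 <
       a, is absorbed by its last letter if i = a, splits it if i > a, and lengthens it if i+1 =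
       a. *)
    case: (ltngtP i.+1 a) => [ia|ai|ia].
    * rewrite (act_low _ _ ia) (act_high _ _ aj) (act_low _ _ ij) -act_scale.
      rewrite (act_run (IH m)) //; first lia.
      by move=> l; rewrite mem_desc; lia.
    * have i1j : (i < j.-1)%N by lia.
      rewrite (act_low _ _ ij).
      move: ai; rewrite ltnS leq_eqVlt => /orP[/eqP ai|ai].
        rewrite -ai in aj *.
        rewrite act_same -push_scale (act_high _ _ aj).
        rewrite (act_desc_last (IH m)); last lia.
        by rewrite !(run_scale (IH m)) (scaleC (IH m)).
      have il : (i < j)%N by lia.
      rewrite (act_high _ _ ai) (act_high _ _ il).
      rewrite (act_desc_mid (IH m)) //; try lia.
      by rewrite !(run_scale (IH m)) (scaleC (IH m)).
    * have il : (i < j)%N by lia.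
      rewrite -ia act_extend (act_high _ _ il) (act_low _ _ ij).
      by rewrite -foldl_rcons -desc_rcons //; lia.
  + have il : (i.+1 < j.+1)%N by lia.
    by rewrite act_extend (act_low _ _ il) (act_low _ _ ij) act_extend.
- move=> [k [|a s]] i im; first by rewrite !act0 empty_scale.
  rewrite -[(k, a :: s)]/(push a (k, s)); move: (k, s) => {k s} t.
  case: (ltngtP i.+2 a) => [ia|ai|<-].
  + have ia' := ltnW ia.
    by rewrite !act_low // (om_braid (IH m)).
  (* Once E_(i+1) has made i+1 the top entry, E_i lowers it to i, and the last E_(i+1) crosses with
     the empty run D(i,i), leaving only y_i. *)
  + move: ai; rewrite ltnS leq_eqVlt => /orP[/eqP->|ai].
      rewrite act_same -!push_scale act_extend (act_high _ _ (ltnSn i)).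
      by rewrite [desc _ _]desc_nil //= st_scaleA mulrC -st_scaleA.
    rewrite (act_high _ _ ai) act_extend (act_high _ _ (ltnSn i)).
    by rewrite [desc _ i]desc_nil.
  + by rewrite act_extend act_extend (act_high _ _ (ltnSn i)) desc_nil.
Qed.

(** * States, their words, and the orbit of the empty word *)

Fixpoint word (s : seq nat) : seq nat :=
  if s is a :: s then word s ++ desc (size s) a else [::].

Fixpoint wf_state (s : seq nat) : bool :=
  if s is a :: s then (a <= size s)%N && wf_state s else true.

(** With a_p = p every run is empty: read as a state, [desc n 0] encodes the empty word. *)
Lemma wf_desc n : wf_state (desc n 0).
Proof.
by elim: n => // n IH; rewrite desc_cons //= IH size_rev size_iota subn0 leqnn.
Qed.

Lemma word_desc n : word (desc n 0) = [::].
Proof.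
elim: n => // n IH; rewrite desc_cons //= IH size_rev size_iota subn0.
exact: desc_nil.
Qed.

Lemma word_lt s : wf_state s -> {in word s, forall j, (j.+1 < size s)%N}.
Proof.
elim: s => //= a s IH /andP[_ wfs] j; rewrite mem_cat mem_desc.
by case/orP => [/IH|] ; lia.
Qed.

Lemma run_push n a t w : {in w, forall j, (j.+1 < a)%N} ->
  foldl (act n.+1) (push a t) w = push a (foldl (act n) t w).
Proof.
elim: w t => //= j w IH t wa; rewrite act_low ?wa ?mem_head // IH // => i iw.
by rewrite wa // inE iw orbT.
Qed.

Lemma run_desc n b a t : (a <= b)%N ->
  foldl (act n.+1) (push b t) (desc b a) = push a t.
Proof.
move=> ab; rewrite -(subnKC ab); elim: (b - a)%N => [|c IH].
  by rewrite addn0 desc_nil.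
by rewrite addnS desc_cons ?leq_addr // [LHS]/= act_extend IH.
Qed.

(** The inner runs act beneath an empty top run and rebuild [s]; the last run then lowers the top
    entry one by one from [size s] to [a]. No scalar appears. *)
Lemma run_word s : wf_state s ->
  foldl (act (size s)) (1, desc (size s) 0) (word s) = (1, s).
Proof.
elim: s => //= a s IH /andP[ap wfs].
rewrite desc_cons // foldl_cat.
rewrite -[(1, _ :: _)]/(push (size s) (1 : K, desc (size s) 0)).
rewrite run_push; last exact: word_lt.
by rewrite IH // run_desc.
Qed.

(** * Evaluation of states in an Okada module *)

Section Evaluation.

Variables (m : nat) (T : Type) (scale : K -> T -> T) (actT : T -> nat -> T).
Hypothesis omT : okada_module m scale actT.
Variable t0 : T.
Local Notation run := (foldl actT).

Definition eval (u : K * seq nat) : T := scale u.1 (run t0 (word u.2)).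

Lemma eval_push a u : eval (push a u) = run (eval u) (desc (size u.2) a).
Proof. by rewrite /eval /= foldl_cat (run_scale omT). Qed.

Lemma eval_scale k u : eval (st_scale k u) = scale k (eval u).
Proof. by rewrite /eval (om_scaleA omT). Qed.

Definition state_of_size (n : nat) (u : K * seq nat) : bool :=
  wf_state u.2 && (size u.2 == n).

(** Compatibility with single letters is a hypothesis here, so that the induction in [eval_act] can
    pass from letters to runs at the smaller depth. *)
Lemma run_compat n :
    (forall u j, state_of_size n u -> (j.+1 < n)%N ->
     state_of_size n (act n u j) /\ eval (act n u j) = actT (eval u) j) ->
  forall u w, state_of_size n u -> {in w, forall j, (j.+1 < n)%N} ->
  state_of_size n (foldl (act n) u w) /\
  eval (foldl (act n) u w) = run (eval u) w.
Proof.
move=> compat u w; elim: w u => //= j w IH u us wn.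
have [us' <-] := compat u j us (wn _ (mem_head _ _)).
by apply: IH => // i iw; apply: wn; rewrite inE iw orbT.
Qed.

(** Each branch of [act] mirrors an identity between words that holds in every Okada module; for the
    crossing branch it is [act_desc_mid]. The bound on [n] keeps all letters below [m]. *)
Lemma eval_act n u j :
    state_of_size n u -> (n <= m.+1)%N -> (j.+1 < n)%N ->
  state_of_size n (act n u j) /\ eval (act n u j) = actT (eval u) j.
Proof.
elim: n u j => // n IH [k [|a s]] j //.
rewrite /state_of_size /= eqSS => /andP[/andP[an wfs] /eqP sn].
rewrite !ltnS => nm jn; rewrite sn in an.
have {}IH u i : state_of_size n u -> (i.+1 < n)%N ->
    state_of_size n (act n u i) /\ eval (act n u i) = actT (eval u) i.
  by move=> us; apply: IH => //; apply: leqW.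
have szn u : state_of_size n u -> size u.2 = n by case/andP => _ /eqP.
have wfu u : state_of_size n u -> wf_state u.2 by case/andP.
rewrite -[(k, a :: s)]/(push a (k, s)).
have ks : state_of_size n (k, s) by rewrite /state_of_size /= wfs sn eqxx.
move: (k, s) ks => {k s wfs sn} u us.
case: (ltngtP j.+1 a) => [ja|aj|aE].
- have [us' ev] := IH u j us (leq_trans ja an).
  rewrite act_low //= !eval_push ev !szn // an wfu // eqxx; split=> //.
  rewrite (act_run omT) //; first lia.
  by move=> i; rewrite mem_desc; lia.
- move: aj; rewrite ltnS leq_eqVlt => /orP[/eqP aE|aj].
    subst a; rewrite act_same eval_scale eval_push /= szn // an wfu // eqxx.
    split=> //; rewrite (act_desc_last omT) //; lia.
  rewrite act_high //.
  have wn : {in desc j.-1 a, forall i, (i.+1 < n)%N}.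
    by move=> i; rewrite mem_desc; lia.
  have [us' ev] := @run_compat n IH (st_scale (y j.-1) u) _ us wn.
  rewrite !eval_push /= ev [in LHS]eval_scale !szn // wfu // eqxx (ltnW jn); split=> //.
  by rewrite (act_desc_mid omT) ?aj // !(run_scale omT).
- subst a; rewrite act_extend !eval_push /= szn // wfu // eqxx (ltnW jn).
  by split=> //; rewrite (@desc_rcons _ j) // foldl_rcons.
Qed.

Lemma eval_run n u w :
    state_of_size n u -> (n <= m.+1)%N -> {in w, forall j, (j.+1 < n)%N} ->
  state_of_size n (foldl (act n) u w) /\
  eval (foldl (act n) u w) = run (eval u) w.
Proof. by move=> us nm; apply: run_compat us => u' j /eval_act; apply. Qed.

End Evaluation.


(** * States given by a function of the position *)

Lemma wf_rev_mkseq n f :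
  (forall p, (p < n)%N -> (f p <= p)%N) -> wf_state (rev (mkseq f n)).
Proof.
elim: n => // n IH fle; rewrite mkseqS rev_rcons /= size_rev size_mkseq fle //.
by apply: IH => p pn; apply: fle; apply: leqW.
Qed.

Lemma wf_state_nth s p :
  wf_state s -> (p < size s)%N -> (nth 0%N (rev s) p <= p)%N.
Proof.
elim: s => //= a s IH /andP[ap wfs]; rewrite ltnS rev_cons nth_rcons size_rev.
by case: ltngtP => // [ps _|-> //]; apply: IH.
Qed.

Lemma word_rev_mkseq n f :
  word (rev (mkseq f n)) = flatten (mkseq (fun p => desc p (f p)) n).
Proof.
elim: n => // n IH; rewrite !mkseqS rev_rcons /= size_rev size_mkseq IH.
by rewrite flatten_rcons.
Qed.

(** The right-hand side lists the letters as [code_letter] does. *)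
Lemma desc_mkseq p c :
  (c <= p)%N -> desc p (p - c) = mkseq (fun k => (p - k.+1)%N) c.
Proof.
elim: c => [|c IH] cp; first by rewrite subn0 desc_nil.
rewrite mkseqS -IH ?(ltnW cp) // desc_rcons; last by lia.
by rewrite subnSK.
Qed.

(** * Codes of permutations *)

Section Codes.

Variable N : nat.
Implicit Types s t : 'S_N.

(** A value [u p] is its own rank, the number of [q] with [u q < u p], so the order alone determines
    the permutation. *)
Lemma perm_order_inj s t :
  (forall p q, (s p < s q)%N = (t p < t q)%N) -> s = t.
Proof.
have rank (u : 'S_N) p : #|[set q | (u q < u p)%N]| = u p :> nat.
  have -> : [set q | (u q < u p)%N] = u @^-1: [set i : 'I_N | (i < u p)%N].
    by apply/setP => q; rewrite !inE.
  rewrite (card_preimset _ (@perm_inj _ u)).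
  by rewrite -sum1dep_card (big_ord_narrow (ltnW (ltn_ord _))) sum1_card card_ord.
move=> st; apply/permP => p; apply: val_inj; rewrite /= -(rank s) -(rank t).
by congr #|pred_of_set _|; apply/setP => q; rewrite !inE st.
Qed.

(* The elements [q < p] placed after [p] form an up-set for the relative order
   of the elements below [p], so they are determined by their number. *)
Lemma code_inj s t : code s =1 code t -> s = t.
Proof.
move=> st; apply: invg_inj; apply: perm_order_inj.
set u : 'S_N := (s^-1)%g; set v : 'S_N := (t^-1)%g.
have neq (w : 'S_N) (p q : 'I_N) : (q < p)%N -> (w p < w q)%N = ~~ (w q < w p)%N.
  move=> qp; rewrite -leqNgt ltn_neqAle andb_idl // => _.
  by rewrite (inj_eq val_inj) (inj_eq perm_inj) neq_ltn qp orbT.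
suff below n (p q : 'I_N) : (q < p < n)%N -> (u p < u q)%N = (v p < v q)%N.
  move=> p q; case: (ltngtP q p) => [qp|pq|/val_inj ->]; last by rewrite !ltnn.
    by apply: (below p.+1); rewrite qp leqnn.
  have /= := below q.+1 q p; rewrite pq leqnn => /(_ isT) e.
  by rewrite -[LHS]negbK -(neq u) // e (neq v) // negbK.
elim: n p q => [|n IH] p q /andP[qp]; first by rewrite ltn0.
rewrite ltnS leq_eqVlt => /orP[/eqP pn|pn]; last by apply: IH; rewrite qp.
have same (i j : 'I_N) : (i < p)%N -> (j < p)%N -> (u i < u j)%N = (v i < v j)%N.
  move=> ip jp; case: (ltngtP j i) => [ji|ij|/val_inj ->]; last by rewrite !ltnn.
    by apply: IH; rewrite ji -pn.
  by rewrite -[LHS]negbK -(neq u) // (IH j i) ?ij -?pn // (neq v) // negbK.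
pose A (w : 'S_N) := [set i : 'I_N | (i < p)%N && (w p < w i)%N].
have cardA : #|A u| = #|A v| := st p.
have AE : A u = A v.
  apply/eqP; case: (boolP (A u \subset A v)) => [uv|/subsetPn[i]].
    by rewrite eqEcard uv cardA leqnn.
  (* Now [i] is in [A u] but not in [A v]. A [j] in [A v] outside [A u] would give u j < u p < u i
     and v i < v p < v j, although both orders agree below [p]. *)
  rewrite eq_sym eqEcard -cardA leqnn andbT !inE => /andP[ip ui].
  rewrite ip (neq v) // negbK => vi; apply/subsetP => j.
  rewrite !inE => /andP[jp vj]; rewrite jp (neq u) //; apply/negP => uj.
  have := same j i jp ip; rewrite (ltn_trans uj ui).
  by move/esym/ltn_trans/(_ (ltn_trans vi vj)); rewrite ltnn.
by have := congr1 (fun B : {set 'I_N} => q \in B) AE; rewrite !inE qp.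
Qed.

Definition code_at s (p : nat) : nat := oapp (code s) 0%N (insub p).

Lemma code_at_ord s (p : 'I_N) : code_at s p = code s p.
Proof. by rewrite /code_at valK. Qed.

(** A factor of c_p letters starting at p-1 ends at p - c_p, which is therefore the entry a_p; the
    reversal puts the last run at the head. *)
Definition perm_state s : seq nat := rev (mkseq (fun p => p - code_at s p)%N N).

Lemma size_perm_state s : size (perm_state s) = N.
Proof. by rewrite size_rev size_mkseq. Qed.

Lemma wf_perm_state s : wf_state (perm_state s).
Proof. by apply: wf_rev_mkseq => p _; apply: leq_subr. Qed.

Lemma nth_perm_state s (p : 'I_N) :
  nth 0%N (rev (perm_state s)) p = (p - code s p)%N.
Proof. by rewrite revK nth_mkseq // code_at_ord. Qed.

Lemma perm_state_inj : injective perm_state.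
Proof.
move=> s t st; apply: code_inj => p.
have := nth_perm_state s p; rewrite st nth_perm_state => e.
by rewrite -[LHS](subKn (code_le s p)) -e subKn // code_le.
Qed.

(** By counting: codes embed the permutations into the families (c_p) with c_p <= p, of which there
    are N!, so every family is a code. *)
Lemma perm_state_onto w :
  wf_state w -> size w = N -> exists s, perm_state s = w.
Proof.
move=> wfw sw.
pose cd s : {dffun forall p : 'I_N, 'I_p.+1} := [ffun p => inord (code s p)].
have cdE s p : cd s p = code s p :> nat.
  by rewrite ffunE inordK // ltnS code_le.
have cd_inj : injective cd.
  by move=> s t st; apply: code_inj => p; rewrite -!cdE st.
have card_cd : (#|{dffun forall p : 'I_N, 'I_p.+1}| <= #|{: 'S_N}|)%N.
  rewrite card_dep_ffun card_Sn fact_prod big_add1 /= big_mkord.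
  rewrite foldrE big_image /= leq_eqVlt; apply/orP; left.
  by apply/eqP/eq_bigr => i _; rewrite card_ord.
(* The code prescribed by [w]: c_p = p - a_p. *)
pose d : {dffun forall p : 'I_N, 'I_p.+1} :=
  [ffun p : 'I_N => inord (p - nth 0%N (rev w) p)].
have /codomP[s ds] := inj_card_onto cd_inj card_cd d.
exists s; apply: (can_inj revK); apply: (@eq_from_nth _ 0%N).
  by rewrite !size_rev size_mkseq.
rewrite size_rev size_perm_state => p pN.
rewrite (nth_perm_state s (Ordinal pN)) -cdE -ds ffunE /= inordK ?ltnS ?leq_subr //.
by rewrite subKn // wf_state_nth ?sw.
Qed.

(** An index out of range multiplies by [one]. *)
Definition right_mul (T : Type) (one : T) (mul : T -> T -> T)
    (E : 'I_N.-1 -> T) (t : T) (j : nat) : T :=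
  mul t (oapp E one (insub j)).

(** The factor at position p is the run D(p, p - c_p), and the word of the state concatenates these
    runs. *)
Lemma code_prod_word (T : Type) (one : T) (mul : Monoid.law one)
    (E : 'I_N.-1 -> T) s :
  code_prod one mul E s =
    foldl (right_mul one mul E) one (word (perm_state s)).
Proof.
have runE w (z : T) : foldl (right_mul one mul E) z w =
    mul z (\big[mul/one]_(j <- w) oapp E one (insub j)).
  elim: w z => [|j w IH] z /=; first by rewrite big_nil Monoid.mulm1.
  by rewrite IH big_cons Monoid.mulmA.
rewrite runE Monoid.mul1m word_rev_mkseq big_flatten big_map -[N in iota 0 N]subn0 big_mkord.
apply: eq_bigr => p _; rewrite code_at_ord desc_mkseq ?code_le //.
rewrite big_map -[X in iota 0 X]subn0 big_mkord.
by apply: eq_bigr => k _; rewrite -[(p - k.+1)%N]/(val (code_letter k)) valK.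
Qed.

End Codes.

Lemma right_mul_okada_module (N : nat) (T : Type) (one : T)
    (mul : Monoid.law one) (scale : K -> T -> T) (E : 'I_N.-1 -> T) :
    (forall k l t, scale k (scale l t) = scale (k * l) t) ->
    (forall k t u, mul (scale k t) u = scale k (mul t u)) ->
    (forall k t u, mul t (scale k u) = scale k (mul t u)) ->
    (forall i, mul (E i) (E i) = scale (x i) (E i)) ->
    (forall i j : 'I_N.-1, (i.+1 < j)%N -> mul (E i) (E j) = mul (E j) (E i)) ->
    (forall i j : 'I_N.-1, j = i.+1 :> nat ->
      mul (mul (E j) (E i)) (E j) = scale (y i) (E j)) ->
  okada_module N.-1 scale (right_mul one mul E).
Proof.
move=> scaleA scaleAl scaleAr EI EC EB.
have mulA t u v : mul t (mul u v) = mul (mul t u) v by exact: Monoid.mulmA.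
have rmE t i (iN : (i < N.-1)%N) :
  right_mul one mul E t i = mul t (E (Ordinal iN)) by rewrite /right_mul insubT.
split=> //.
- by move=> k t i; apply: scaleAl.
- by move=> t i iN; rewrite !rmE -mulA EI scaleAr.
- move=> t i j /andP[ij jN]; have iN : (i < N.-1)%N by lia.
  by rewrite !rmE -!mulA EC.
- move=> t i iN; have iN' := ltnW iN.
  by rewrite !rmE -!mulA [mul (E _) _]mulA EB // scaleAr.
Qed.

(** * Reduction of words to normal form *)

Section NormalForms.

Variables (N : nat) (T : Type) (one : T) (mul : Monoid.law one).
Variables (scale : K -> T -> T) (E : 'I_N.-1 -> T).
Hypothesis omT : okada_module N.-1 scale (right_mul one mul E).
Hypothesis scale1 : scale 1 one = one.
Local Notation run := (foldl (right_mul one mul E)).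

Lemma eval_perm_state k s :
  eval scale (right_mul one mul E) one (k, perm_state s) =
    scale k (code_prod one mul E s).
Proof. by rewrite code_prod_word. Qed.

(** Acting by [w] on the state of the empty word gives a scalar and a well-formed state, which is
    some [perm_state s]; evaluating it recovers the product along [w]. *)
Lemma run_normal_form w : {in w, forall j, (j < N.-1)%N} ->
  exists k s, run one w = scale k (code_prod one mul E s).
Proof.
move=> wN; pose u : K * seq nat := (1, desc N 0).
have us : state_of_size N u.
  by rewrite /state_of_size wf_desc size_rev size_iota subn0 eqxx.
have evu : eval scale (right_mul one mul E) one u = one.
  by rewrite /eval word_desc.
have [||us'] := @eval_run _ _ _ _ omT one N u w us; first lia.
  by move=> j /wN; lia.
rewrite evu => <-; case: (foldl _ u w) us' => k w' /andP[/= wfw /eqP sw].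
by have [s <-] := perm_state_onto wfw sw; exists k, s; rewrite eval_perm_state.
Qed.

End NormalForms.

End OkadaModules.

(** * Free monoid elements as lists of indices *)

Section Letters.

Variable N : nat.

(** Indices out of range are dropped; by [perm_word_lt] the words of permutations contain none. *)
Definition letters (w : seq nat) : {fmonom 'I_N.-1} := FMonom (pmap insub w).

Lemma lettersK w : {in w, forall j, (j < N.-1)%N} ->
  map val (letters w : seq 'I_N.-1) = w.
Proof.
move=> wN; rewrite /= (pmap_filter (insubK _)); apply/all_filterP/allP => j /wN jN.
by rewrite insubT.
Qed.

Lemma perm_word_lt (s : 'S_N) :
  {in word (perm_state s), forall j, (j < N.-1)%N}.
Proof.
by move=> j /(word_lt (wf_perm_state s)); rewrite size_perm_state; lia.
Qed.

Lemma fmonom_rcons (I : choiceType) (l : seq I) (i : I) :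
  FMonom (rcons l i) = mmul (FMonom l) (fmu i).
Proof. by apply: val_inj; rewrite /= fmM fmU cats1. Qed.

(** The induction removes letters at the right end, where [right_mul] appends them. *)
Lemma fmonom_run (T : Type) (one : T) (mul : Monoid.law one)
    (pi : {fmonom 'I_N.-1} -> T) :
    pi mone = one -> (forall u v, pi (mmul u v) = mul (pi u) (pi v)) ->
  forall u : {fmonom 'I_N.-1},
    pi u = foldl (right_mul one mul (fun i => pi (fmu i))) one (map val u).
Proof.
move=> pi1 piM [l]; elim/last_ind: l => [|l i IH].
  by rewrite -[RHS]pi1; congr pi; apply: val_inj; rewrite /= fm1.
by rewrite fmonom_rcons piM IH fmM fmU map_cat foldl_cat /= /right_mul valK.
Qed.

Lemma run_perm_state (K : fieldType) (x y : nat -> K) (s : 'S_N) :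
  foldl (act x y N) (1, desc N 0) (word (perm_state s)) = (1, perm_state s).
Proof.
by have := run_word x y (wf_perm_state s); rewrite size_perm_state.
Qed.

End Letters.

(** * The monoid *)

Section OkadaMonoid.

Variable N : nat.
Local Notation pi := (pm_pi (@okada_mrel N)).
(** The monoid is the case where all parameters are 1; the rationals only carry the universal
    action. *)
Let one_seq : nat -> rat := fun=> 1.

Lemma okada_monoid_module :
  okada_module one_seq one_seq N.-1 (fun (_ : rat) (t : okada_monoid N) => t)
    (right_mul 1%g *%g (@okada_mgen N)).
Proof.
apply: right_mul_okada_module => //= [i|i j ij|i j ij].
- by rewrite -[LHS]pm_piM; apply/pm_piE/Cong_rel/OkM_idem.
- by rewrite -[LHS]pm_piM -[RHS]pm_piM; apply/pm_piE/Cong_rel/OkM_comm; rewrite ij.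
- rewrite -[(okada_mgen j * _)%g]pm_piM -[LHS]pm_piM.
  by apply/pm_piE/Cong_rel/OkM_braid.
Qed.

(** The universal action descends to the monoid. All starting states are covered together, since the
    second factor of a product acts on the state reached by the first. *)
Lemma okada_congruence_act (u v : {fmonom 'I_N.-1}) t :
  congruence (@okada_mrel N) u v ->
  foldl (act one_seq one_seq N) t (map val u) =
    foldl (act one_seq one_seq N) t (map val v).
Proof.
have om := act_okada_module one_seq one_seq N.-1 N.
have scale1 u' : st_scale (1 : rat) u' = u'.
  by case: u' => k w; rewrite /st_scale mul1r.
move=> uv; elim: uv t => {u v} [u v uv t|//|u v _ IH t|u v w _ IHu _ IHv t|].
- case: uv => [i|i j ij|i j ij]; rewrite !fmM !fmU /=.
  + by rewrite (om_idem om) // scale1.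
  + case/orP: ij => ij; first by rewrite (om_comm om) ?ij /=.
    by rewrite -(om_comm om) ?ij /=.
  + have := ltn_ord j; rewrite ij => ji.
    by rewrite (om_braid om) // scale1.
- by rewrite IH.
- by rewrite IHu IHv.
- by move=> u u' v v' _ IHu _ IHv t; rewrite !fmM !map_cat !foldl_cat IHu IHv.
Qed.

Lemma okada_monoid_pi u :
  pi u = foldl (right_mul 1%g *%g (@okada_mgen N)) 1%g (map val u).
Proof. by apply: fmonom_run => // v w; apply: pm_piM. Qed.

Lemma okada_monoid_eltE s :
  okada_monoid_elt s = pi (letters N (word (perm_state s))).
Proof.
rewrite okada_monoid_pi lettersK ?[LHS]code_prod_word //.
exact: perm_word_lt.
Qed.

(** Injectivity: acting on the state of the empty word recovers [perm_state s]. Surjectivity: every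
    word has a normal form, and scalars act trivially. *)
Lemma okada_monoid_elt_bij : bijective (fun s : 'S_N => okada_monoid_elt s).
Proof.
have inj : injective (fun s : 'S_N => okada_monoid_elt s).
  move=> s t; rewrite /= !okada_monoid_eltE => /pm_piE.
  move=> /(okada_congruence_act (1, desc N 0)).
  rewrite !lettersK; try exact: perm_word_lt.
  by rewrite !run_perm_state => -[] /perm_state_inj.
have surj a : exists s : 'S_N, okada_monoid_elt s == a.
  rewrite -[a]pm_reprK okada_monoid_pi.
  have [||k [s ->]] := run_normal_form okada_monoid_module _ (w := map val (generic_quotient.repr a)).
  - by [].
  - by move=> j /mapP[i _ ->]; apply: ltn_ord.
  by exists s.
exists (fun a => xchoose (surj a)) => [s|a]; last exact: (eqP (xchooseP (surj a))).
by apply: inj; apply: (eqP (xchooseP (surj _))).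
Qed.

End OkadaMonoid.

(** * The algebra *)

Section OkadaAlgebra.

Variables (N : nat) (K : fieldType) (X : N.-1.-tuple K) (Y : N.-2.-tuple K).

Local Notation x := (fun i => nth 0 X i).
Local Notation y := (fun i => nth 0 Y i).
Local Notation free_algebra := {malg K[{fmonom 'I_N.-1}]}.
Local Notation pi := (oka_pi X Y).

Lemma malgUM (u v : {fmonom 'I_N.-1}) :
  << mmul u v >> = << u >> * << v >> :> free_algebra.
Proof. by rewrite malgM_def fgmulUU mulr1. Qed.

Lemma malgUZ (u : {fmonom 'I_N.-1}) (c : K) :
  << c *g u >> = c *: << u >> :> free_algebra.
Proof. by rewrite -mul_malgC malgM_def fgmulUU mulr1 mul1m. Qed.

Lemma okada_algebra_module :
  okada_module x y N.-1 (fun k (t : okada_algebra X Y) => k *: t)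
    (right_mul 1 *%R (okada_agen X Y)).
Proof.
have piE a b : okada_relator X Y (a - b) -> pi a = pi b.
  by move=> ab; apply/oka_piE/okada_idealP/generated_ideal_sub.
apply: right_mul_okada_module => [k l t|k t u|k t u|i|i j ij|i j ij] /=.
- exact: scalerA.
- by rewrite scalerAl.
- by rewrite scalerAr.
- rewrite -[LHS]oka_piM -[RHS]oka_piZ; apply: piE.
  by rewrite -(tnth_nth 0); apply: OkA_idem.
- by rewrite -[LHS]oka_piM -[RHS]oka_piM; apply/piE/OkA_comm; rewrite ij.
- rewrite -[okada_agen X Y j * _]oka_piM -[LHS]oka_piM -[RHS]oka_piZ.
  (* Since i+1 = j < N-1, the index [i] is in the range of [Y]. *)
  have iN : (i < N.-2)%N by have := ltn_ord j; lia.
  apply: piE; rewrite -[nat_of_ord i]/(nat_of_ord (Ordinal iN)) -(tnth_nth 0).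
  exact: OkA_braid.
Qed.

Lemma okada_algebra_pi (u : {fmonom 'I_N.-1}) :
  pi << u >> = foldl (right_mul 1 *%R (okada_agen X Y)) 1 (map val u).
Proof.
apply: (fmonom_run (pi := fun u => pi << u >>)) => // v w.
by rewrite malgUM [LHS]oka_piM.
Qed.

Lemma okada_algebra_eltE (s : 'S_N) :
  okada_algebra_elt X Y s = pi << letters N (word (perm_state s)) >>.
Proof.
rewrite okada_algebra_pi lettersK; last exact: perm_word_lt.
by rewrite [LHS]code_prod_word.
Qed.

Definition st_coef (w : seq nat) (u : K * seq nat) : K :=
  if u.2 == w then u.1 else 0.

(* The coefficient at [w] of [v0 . a], where [v0] is the state of the empty
   word, in the vector space on states. *)
Definition state_coef (w : seq nat) (a : free_algebra) : K :=
  mmap (idfun : K -> K) (fun m : {fmonom 'I_N.-1} =>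
    st_coef w (foldl (act x y N) (1, desc N 0) (map val m))) a.

HB.instance Definition _ w := GRing.isAdditive.Build free_algebra K
  (state_coef w) (mmap_is_additive (f := idfun)).

Lemma state_coefU w c (m : {fmonom 'I_N.-1}) :
  state_coef w << c *g m >> =
    c * st_coef w (foldl (act x y N) (1, desc N 0) (map val m)).
Proof. exact: (mmapU (f := idfun)). Qed.

Fact state_coef_scalable w : scalable_for *%R (state_coef w).
Proof.
move=> c a; rewrite [a]monalgE scaler_sumr !raddf_sum mulr_sumr.
apply: eq_bigr => m _.
by rewrite malgUZ scalerA -!malgUZ /= !state_coefU mulrA.
Qed.

HB.instance Definition _ w := GRing.isScalable.Build K free_algebra K *%R
  (state_coef w) (state_coef_scalable w).

(** On the state reached by [m], both terms of the relator act alike, and the scalar of the second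
    one passes through [m']; so the coefficients cancel. *)
Lemma state_coef_relator w (m m' : {fmonom 'I_N.-1}) r :
  okada_relator X Y r -> state_coef w (<< m >> * r * << m' >>) = 0.
Proof.
have om := act_okada_module x y N.-1 N.
have coefZ k u : st_coef w (st_scale k u) = k * st_coef w u.
  by rewrite /st_coef /=; case: ifP => // _; rewrite mulr0.
case=> [i|i j ij|k i j ik jk];
  rewrite /okada_fgen mulrBr mulrBl raddfB /= -?malg_scaleAr -?scalerAl ?linearZ /=;
  rewrite -!malgUM !state_coefU !mul1r !fmM !fmU !map_cat !foldl_cat /=.
- rewrite (om_idem om) // (run_scale om) coefZ (tnth_nth 0).
  exact: subrr.
- case/orP: ij => ij; first by rewrite (om_comm om) ?ij //= subrr.
  by rewrite -(om_comm om) ?ij //= subrr.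
- have := ltn_ord j; rewrite jk -ik => iN.
  rewrite (om_braid om) // (run_scale om) coefZ (tnth_nth 0) ik.
  exact: subrr.
Qed.

(** Expanding both cofactors of each relator into monomials reduces this to [state_coef_relator]. *)
Lemma state_coef_ideal w a : a \in okada_ideal X Y -> state_coef w a = 0.
Proof.
move/okada_idealP; elim=> [|b r c u rR _ IH]; first exact: raddf0.
rewrite raddfD /= IH addr0 -mulrA [b]monalgE mulr_suml raddf_sum big1 // => m _.
rewrite /= mulrA [c]monalgE mulr_sumr raddf_sum big1 // => m' _ /=.
rewrite malgUZ [<< c@_m' *g m' >>]malgUZ -!scalerAl -malg_scaleAr !linearZ /=.
by rewrite state_coef_relator // !mulr0.
Qed.

Lemma okada_algebra_basis :
  is_basis (fun s : 'S_N => okada_algebra_elt X Y s).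
Proof.
split=> [c c0 s|u].
  (* The vanishing combination lifts to an element of the ideal; the coefficient at [perm_state s]
     vanishes on the ideal and equals [c s] on the lift. *)
  pose a : free_algebra :=
    \sum_s c s *: << letters N (word (perm_state s)) >>.
  have aI : a \in okada_ideal X Y.
    rewrite -[a]subr0; apply/oka_piE.
    rewrite [RHS](_ : _ = 0); last exact: raddf0.
    rewrite -[RHS]c0 /a (big_morph pi (oka_piD X Y) (raddf0 _)).
    by apply: eq_bigr => t _; rewrite [LHS]oka_piZ okada_algebra_eltE.
  rewrite -[RHS](state_coef_ideal (perm_state s) aI) raddf_sum (bigD1 s) //=.
  rewrite big1 ?addr0 => [|t ts]; rewrite linearZ /= state_coefU mul1r lettersK;
    try exact: perm_word_lt.
    by rewrite run_perm_state /st_coef eqxx mulr1.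
  by rewrite run_perm_state /st_coef (inj_eq (@perm_state_inj N)) (negPf ts) mulr0.
pose spanned (v : okada_algebra X Y) :=
  exists c : 'S_N -> K, v = \sum_s c s *: okada_algebra_elt X Y s.
(* Classes of monomials span the quotient, so these alone need a normal form. *)
suff spanU m : spanned (pi << m >>).
  have spanD v w : spanned v -> spanned w -> spanned (v + w).
    move=> [c ->] [d ->]; exists (fun s => c s + d s); rewrite -big_split.
    by apply: eq_bigr => s _; rewrite scalerDl.
  have spanZ k v : spanned v -> spanned (k *: v).
    move=> [c ->]; exists (fun s => k * c s); rewrite scaler_sumr.
    by apply: eq_bigr => s _; rewrite scalerA.
  have span0 : spanned 0.
    by exists (fun=> 0); rewrite big1 // => s _; rewrite scale0r.
  rewrite -/(spanned u) -[u]oka_reprK [generic_quotient.repr u]monalgE.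
  rewrite (big_morph pi (oka_piD X Y) (raddf0 _)).
  elim/big_ind: _ => // m _; rewrite malgUZ [oka_pi _ _ _]oka_piZ.
  exact/spanZ/spanU.
rewrite okada_algebra_pi.
have [||k [s ->]] :=
    run_normal_form okada_algebra_module _ (w := map val m).
- exact: scale1r.
- by move=> j /mapP[i _ ->]; apply: ltn_ord.
exists (fun t => k *+ (t == s)); rewrite (bigD1 s) //= eqxx big1 ?addr0 //.
by move=> t /negPf ->; rewrite scale0r.
Qed.

End OkadaAlgebra.

(** * From a finite basis to the dimension *)

Lemma basis_has_dim (K : fieldType) (V : lmodType K) (I : finType)
  (v : I -> V) : is_basis v -> has_dim V #|I|.
Proof.
move=> [free span]; pose c u := projT1 (cid (span u)).
have cE u : u = \sum_i c u i *: v i := projT2 (cid (span u)).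
(* Uniqueness of coordinates makes the chosen coordinate map linear and a left inverse of taking
   combinations. *)
have c_uniq u d : u = \sum_i d i *: v i -> c u =1 d.
  move=> ud i; apply/eqP; rewrite -subr_eq0; apply/eqP; move: i.
  apply: free; under eq_bigr do rewrite scalerBl.
  by rewrite sumrB -cE -ud subrr.
constructor; exists (fun u => \row_i c u (enum_val i)).
  move=> k u w; apply/rowP => i; rewrite !mxE.
  apply: (c_uniq _ (fun i => k * c u i + c w i)).
  rewrite {1}(cE u) {1}(cE w) scaler_sumr -big_split.
  by apply: eq_bigr => j _; rewrite scalerDl scalerA.
exists (fun r : 'rV_#|I| => \sum_i r ord0 (enum_rank i) *: v i) => [u|r].
  by rewrite [RHS]cE; apply: eq_bigr => i _; rewrite mxE enum_rankK.
apply/rowP => i; rewrite mxE.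
by rewrite (c_uniq _ (fun i => r ord0 (enum_rank i))) // enum_valK.
Qed.

Theorem theorem3p1 (N : nat) (N_gt0 : (0 < N)%N) (K : fieldType)
    (X : N.-1.-tuple K) (Y : N.-2.-tuple K) :
  [/\ bijective (fun s : 'S_N => okada_monoid_elt s),
      is_basis (fun s : 'S_N => okada_algebra_elt X Y s) &
      has_dim (okada_algebra X Y) N`!].
Proof.
have basis := okada_algebra_basis X Y.
split; [exact: okada_monoid_elt_bij | exact: basis |].
by rewrite -card_Sn; apply: basis_has_dim basis.
Qed.
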